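(* Assume the following two statements hold. (I) There exists a unique way of choosing the signs of the equivariant weights $\mathsf{w}_\pi$, for all solid partitions $\pi$, such that $$\sum_{\pi} L_\pi(d_1,d_2,d_3,d_4)\,\mathsf{w}_\pi\,q^{|\pi|}= M(-q)^{\frac{(d_1\lambda_1+d_2\lambda_2+d_3\lambda_3+d_4\lambda_4)(-\lambda_1\lambda_2\lambda_3-\lambda_1\lambda_2\lambda_4-\lambda_1\lambda_3\lambda_4-\lambda_2\lambda_3\lambda_4)}{\lambda_1\lambda_2\lambda_3\lambda_4}}$$ in $K(d_1,d_2,d_3,d_4)[\![q]\!]$, the sum being over all solid partitions. (II) With the signs of $\mathsf{w}_\pi$ from (I), for every solid partition $\pi$: $L_\pi(0,0,0,-d)\,\mathsf{w}_\pi$ (with $d$ a formal variable) has no pole along $\lambda_1+\lambda_2+\lambda_3=0$; its specialization to $\lambda_1+\lambda_2+\lambda_3=0$ is independent of $\lambda_1,\lambda_2,\lambda_3$; and there exists a rational number $\omega_\pi\in\mathbb{Q}_{>0}$, independent of $d$, such that $$L_\pi(0,0,0,-d)\,\mathsf{w}_\pi\big|_{\lambda_1+\lambda_2+\lambda_3=0}=(-1)^{|\pi|}\,\omega_\pi\prod_{l=1}^{\pi_{111}}(d-(l-1)).$$ Then $$\sum_{\pi}\omega_\pi\,t^{\pi_{111}}\,q^{|\pi|}=e^{t(M(q)-1)},$$ where the sum is over all solid partitions, $t$ is a formal variable, and $M(q)=\prod_{n\geqslant1}(1-q^n)^{-n}$ is the MacMahon function. In particular, for $t=1$, $\sum_\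pi\omega_\pi\,q^{|\pi|}=e^{M(q)-1}$.
   Context: A solid partition $\pi=\{\pi_{ijk}\}_{i,j,k\geqslant1}$ is a sequence of non-negative integers with $\pi_{ijk}\geqslant\pi_{i+1,j,k}$, $\pi_{ijk}\geqslant\pi_{i,j+1,k}$, $\pi_{ijk}\geqslant\pi_{i,j,k+1}$ for all $i,j,k\geqslant1$ and finite size $|\pi|:=\sum\pi_{ijk}<\infty$. Put $$Z_\pi=\sum_{i,j,k\geqslant1}\sum_{l=1}^{\pi_{ijk}}t_1^{i-1}t_2^{j-1}t_3^{k-1}t_4^{l-1},$$ and let $\overline{(\cdot)}$ be the involution on Laurent polynomials with $t_i\mapsto t_i^{-1}$. Define $$\mathsf{V}_\pi:=Z_\pi+\frac{\overline{Z}_\pi}{t_1t_2t_3t_4}-\frac{Z_\pi\overline{Z}_\pi(1-t_1)(1-t_2)(1-t_3)(1-t_4)}{t_1t_2t_3t_4}.$$ $K=\mathbb{Q}(\lambda_1,\lambda_2,\lambda_3,\lambda_4)/(\lambda_1+\lambda_2+\lambda_3+\lambda_4)$ denotes the field $\mathbb{Q}(\lambda_1,\lambda_2,\lambda_3)$ with $\lambda_4:=-(\lambda_1+\lambda_2+\lambda_3)$. After specializing $t_1t_2t_3t_4=1$ (i.e. identifying $t^w$ and $t^{w'}$ when $w-w'\in\mathbb{Z}(1,1,1,1)$), write $\mathsf{V}_\pi=\sum_w c_w t^w$, $w\in\mathbb{Z}^4/\mathbb{Z}(1,1,1,1)$, and set $e_T(-\mathsf{V}_\pi):=\prod_w(w_1\lambda_1+w_2\lambda_2+w_3\lambda_3+w_4\lambda_4)^{-c_w}\in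 K$; the coefficient $c_0$ of the trivial weight is $\leqslant0$, with the conventions $0^0=1$ and $e_T(-\mathsf V_\pi)=0$ if $c_0<0$. The element $(-1)^{|\pi|}e_T(-\mathsf{V}_\pi)$ is a square in $K$, and $\mathsf{w}_\pi:=\pm\sqrt{(-1)^{|\pi|}e_T(-\mathsf{V}_\pi)}\in K$ is defined up to sign. Finally $$L_\pi(d_1,d_2,d_3,d_4):=\prod_{i,j,k\geqslant1}\prod_{l=1}^{\pi_{ijk}}\big((d_1+i-1)\lambda_1+(d_2+j-1)\lambda_2+(d_3+k-1)\lambda_3+(d_4+l-1)\lambda_4\big).$$ $M(-q)^a:=\exp(a\log M(-q))$. *)

(* Defs.v *)
From HB Require Import structures.
From mathcomp Require Import all_boot all_order all_algebra.
From mathcomp Require Import finmap.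
From mathcomp Require Import boolp classical_sets functions cardinality fsbigop.
From mathcomp.multinomials Require Import freeg.
From mathcomp.multinomials Require Import mpoly.

Set Implicit Arguments.
Unset Strict Implicit.
Unset Printing Implicit Defensive.

Import Order.TTheory GRing.Theory Num.Theory.

Local Open Scope ring_scope.

(* Solid partitions. All indices are shifted to start from 0: [p (i, j, k)] is pi_{i+1,j+1,k+1};
   finiteness of the size is the finiteness of the support. *)
Definition is_solid (p : {fsfun nat * nat * nat -> nat with 0%N}) : bool :=
  `[< forall i j k : nat,
        [/\ (p (i.+1, j, k) <= p (i, j, k))%N,
            (p (i, j.+1, k) <= p (i, j, k))%N
          & (p (i, j, k.+1) <= p (i, j, k))%N] >].

Record solid_partition : Type := SolidPartition {
  sp_val :> {fsfun nat * nat * nat -> nat with 0%N};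
  sp_is_solid : is_solid sp_val
}.

HB.instance Definition _ := [isSub for sp_val].
HB.instance Definition _ := [Choice of solid_partition by <:].

Definition sp_size (p : solid_partition) : nat := (\sum_(x <- finsupp p) p x)%N.

Definition sp_of_size (n : nat) : set solid_partition :=
  [set p | sp_size p = n]%classic.

Lemma sp_le_size (p : solid_partition) x : (p x <= sp_size p)%N.
Proof.
case: finsuppP => // xp; rewrite /sp_size.
by rewrite (big_rem x) //= leq_addr.
Qed.

Lemma sp_anti (p : solid_partition) i j k i' j' k' :
  (i' <= i)%N -> (j' <= j)%N -> (k' <= k)%N ->
  (p (i, j, k) <= p (i', j', k'))%N.
Proof.
have /asboolP H := sp_is_solid p.
move=> /subnK <- /subnK <- /subnK <-.
elim: (i - i')%N => [|a IH]; last first.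
  by apply: leq_trans IH; rewrite addSn; case: (H (a + i')%N (j - j' + j')%N (k - k' + k')%N).
elim: (j - j')%N => [|a IH]; last first.
  by apply: leq_trans IH; rewrite addSn; case: (H i' (a + j')%N (k - k' + k')%N).
elim: (k - k')%N => [//|a IH].
by apply: leq_trans IH; rewrite addSn; case: (H i' j' (a + k')%N).
Qed.

Lemma sp_supp (p : solid_partition) i j k :
  p (i, j, k) != 0%N ->
  [/\ (i < sp_size p)%N, (j < sp_size p)%N & (k < sp_size p)%N].
Proof.
rewrite -lt0n => p0.
have key (g : nat -> nat * nat * nat) m : injective g ->
    (forall a, (a <= m)%N -> (0 < p (g a))%N) -> (m < sp_size p)%N.
  move=> ginj gp.
  have sub : {subset map g (iota 0 m.+1) <= finsupp p}.
    move=> x /mapP[a]; rewrite mem_iota add0n ltnS => /andP[_ am] ->.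
    by rewrite mem_finsupp -lt0n gp.
  have u : uniq (map g (iota 0 m.+1)) by rewrite map_inj_uniq ?iota_uniq.
  apply: (@leq_trans (size (finsupp p))).
    by rewrite -[X in (X <= _)%N](size_iota 0) -(size_map g) uniq_leq_size.
  rewrite /sp_size -sum1_size big_seq [X in (_ <= X)%N]big_seq.
  by apply: leq_sum => x; rewrite mem_finsupp lt0n.
split.
- apply: (key (fun a => (a, j, k))) => [a b []//|a ai].
  by apply: leq_trans p0 _; exact: sp_anti.
- apply: (key (fun a => (i, a, k))) => [a b []//|a ai].
  by apply: leq_trans p0 _; exact: sp_anti.
- apply: (key (fun a => (i, j, a))) => [a b []//|a ai].
  by apply: leq_trans p0 _; exact: sp_anti.
Qed.

(* Hence the sums [\sum_(p \in sp_of_size n) _] below are genuine finite sums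
   (fsbigop sums over infinite supports are 0 by convention). *)
Lemma finite_sp_of_size (n : nat) : finite_set (sp_of_size n).
Proof.
pose code (p : solid_partition) : {ffun 'I_n * 'I_n * 'I_n -> 'I_n.+1} :=
  [ffun x : 'I_n * 'I_n * 'I_n =>
    inord (p (x.1.1 : nat, x.1.2 : nat, x.2 : nat))].
have inj : {in sp_of_size n &, injective code}.
  move=> p r; rewrite !inE /sp_of_size /= => pn rn /ffunP E.
  apply: val_inj; apply/fsfunP => -[[i j] k].
  have D (q : solid_partition) : sp_size q = n ->
      ~~ [&& i < n, j < n & k < n]%N -> q (i, j, k) = 0%N.
    move=> qn /negP H; apply/eqP/negPn/negP => /sp_supp; rewrite qn.
    by case=> ? ? ?; apply: H; apply/and3P.
  have [/and3P[ii jj kk]|H] := boolP [&& i < n, j < n & k < n]%N; last first.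
    by rewrite /= !D.
  have := E (Ordinal ii, Ordinal jj, Ordinal kk); rewrite !ffunE /=.
  move=> /(congr1 val); rewrite /= !inordK //.
  - by rewrite ltnS -rn sp_le_size.
  - by rewrite ltnS -pn sp_le_size.
apply: (card_le_finite _ (@finite_finset _ (code @` sp_of_size n)%classic)).
by rewrite (card_le_eqr (inj_card_eq inj)).
Qed.

(* Laurent polynomials in t_1, ..., t_4, as the group ring of Z^4 over Z: an element is a finitely supported function
   from exponents to integer coefficients, with the convolution product (the
   monoid algebras of the library exclude monoids with nontrivial units). *)
Definition laurent : Type := {freeg 'rV[int]_4 / int}.

HB.instance Definition _ := Choice.on laurent.
HB.instance Definition _ := GRing.Zmodule.on laurent.

(* c t^w; the variable t_{i+1} is [tvar i]. *)
Definition lterm (c : int) (w : 'rV[int]_4) : laurent := << c *g w >>.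
Definition lcoef (f : laurent) (w : 'rV[int]_4) : int := freeg.coeff w f.
Definition lsupp (f : laurent) : seq 'rV[int]_4 := freeg.dom f.

Section LaurentRing.

Implicit Types (f g h : laurent) (v w : 'rV[int]_4).

Lemma lsupp_uniq f : uniq (lsupp f).
Proof. exact: uniq_dom. Qed.

Lemma lsuppP f w : (w \in lsupp f) = (lcoef f w != 0).
Proof. exact: mem_dom. Qed.

Lemma laurentP f g : lcoef f =1 lcoef g -> f = g.
Proof. by move=> fg; apply/eqP/freeg_eqP => w; exact: fg. Qed.

Lemma lcoefD f g w : lcoef (f + g) w = lcoef f w + lcoef g w.
Proof. exact: freeg.coeffD. Qed.

Lemma lcoef0 w : lcoef 0 w = 0.
Proof. exact: freeg.coeff0. Qed.

Lemma lcoefN f w : lcoef (- f) w = - lcoef f w.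
Proof. exact: freeg.coeffN. Qed.

Lemma lcoef_term c v w : lcoef (lterm c v) w = c *+ (v == w).
Proof. by rewrite /lcoef coeffU mulr_natr. Qed.

Lemma lcoef_sum (I : Type) (r : seq I) (F : I -> laurent) w :
  lcoef (\sum_(i <- r) F i) w = \sum_(i <- r) lcoef (F i) w.
Proof.
by apply: (big_morph (lcoef^~ w)) => [f g|]; rewrite ?lcoefD ?lcoef0.
Qed.

Lemma lterm0 w : lterm 0 w = 0.
Proof. exact: freegU0. Qed.

Lemma ltermD a b w : lterm (a + b) w = lterm a w + lterm b w.
Proof. by rewrite /lterm freegUD. Qed.

Lemma laurentE (d : seq 'rV[int]_4) f : uniq d -> {subset lsupp f <= d} ->
  f = \sum_(v <- d) lterm (lcoef f v) v.
Proof.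
move=> ud fd; apply: laurentP => w; rewrite lcoef_sum.
have [wd|wd] := boolP (w \in d).
  rewrite (bigD1_seq w) //= lcoef_term eqxx big1 ?addr0 // => v vw.
  by rewrite lcoef_term (negPf vw).
rewrite big1_seq => [|v /= vd].
  by apply/eqP; apply: contraNT wd => fw; rewrite fd // lsuppP.
by rewrite lcoef_term; case: eqP wd => // <-; rewrite vd.
Qed.

Definition laurent_one : laurent := lterm 1 0.

Definition laurent_mul f g : laurent :=
  \sum_(v <- lsupp f) \sum_(w <- lsupp g) lterm (lcoef f v * lcoef g w) (v + w).

Lemma laurent_mulC : commutative laurent_mul.
Proof.
move=> f g; rewrite /laurent_mul exchange_big /=.
by apply: eq_bigr => v _; apply: eq_bigr => w _; rewrite mulrC addrC.
Qed.

Lemma big_lsupp (F : int -> 'rV[int]_4 -> laurent) (d : seq 'rV[int]_4) f :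
  (forall v, F 0 v = 0) -> uniq d -> {subset lsupp f <= d} ->
  \sum_(v <- lsupp f) F (lcoef f v) v = \sum_(v <- d) F (lcoef f v) v.
Proof.
move=> F0 ud fd; rewrite [RHS](bigID (mem (lsupp f))) /= [X in _ + X]big1 ?addr0.
  rewrite -[RHS]big_filter; apply: perm_big; apply: uniq_perm.
  - exact: lsupp_uniq.
  - exact: filter_uniq.
  - by move=> v; rewrite mem_filter; case: (boolP (v \in lsupp f)) => // /fd ->.
by move=> v; rewrite lsuppP negbK => /eqP ->.
Qed.

Lemma laurent_mulDl : left_distributive laurent_mul +%R.
Proof.
move=> f g h; pose d := undup (lsupp f ++ lsupp g).
pose F a v := \sum_(w <- lsupp h) lterm (a * lcoef h w) (v + w).
have F0 v : F 0 v = 0 by apply: big1 => w _; rewrite mul0r lterm0.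
have FD a b v : F (a + b) v = F a v + F b v.
  by rewrite /F -big_split; apply: eq_bigr => w _; rewrite mulrDl ltermD.
rewrite -[LHS]/(\sum_(v <- _) F (lcoef _ v) v).
rewrite -[X in _ = X + _]/(\sum_(v <- _) F (lcoef _ v) v).
rewrite -[X in _ = _ + X]/(\sum_(v <- _) F (lcoef _ v) v).
rewrite !(@big_lsupp F d) ?undup_uniq //.
- by rewrite -big_split; apply: eq_bigr => v _; rewrite lcoefD FD.
- by move=> v vg; rewrite mem_undup mem_cat vg orbT.
- by move=> v vf; rewrite mem_undup mem_cat vf.
- move=> v; rewrite lsuppP mem_undup mem_cat !lsuppP lcoefD.
  by apply: contraR; rewrite negb_or !negbK => /andP[/eqP -> /eqP ->].
Qed.

Lemma laurent_mulDr : right_distributive laurent_mul +%R.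
Proof. by move=> f g h; rewrite laurent_mulC laurent_mulDl !(laurent_mulC f). Qed.

Lemma laurent_mul0 f : laurent_mul 0 f = 0.
Proof.
rewrite /laurent_mul big1_seq // => v /=.
by rewrite lsuppP lcoef0 eqxx.
Qed.

Lemma laurent_mul_term a b v w :
  laurent_mul (lterm a v) (lterm b w) = lterm (a * b) (v + w).
Proof.
pose G c u := \sum_(x <- lsupp (lterm b w)) lterm (c * lcoef (lterm b w) x) (u + x).
have sub c u : {subset lsupp (lterm c u) <= [:: u]}.
  by move=> x; rewrite lsuppP lcoef_term inE; case: (eqVneq u x) => // _; rewrite mulr0n eqxx.
have G0 u : G 0 u = 0 by apply: big1 => x _; rewrite mul0r lterm0.
rewrite -[LHS]/(\sum_(u <- _) G (lcoef _ u) u) (@big_lsupp G [:: v]) //.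
rewrite big_seq1 lcoef_term eqxx /G.
rewrite (@big_lsupp (fun c x => lterm (a *+ true * c) (v + x)) [:: w]) //.
  by rewrite big_seq1 lcoef_term eqxx.
by move=> x; rewrite mulr0 lterm0.
Qed.

Lemma laurent_suml (I : Type) (r : seq I) (F : I -> laurent) f :
  laurent_mul (\sum_(i <- r) F i) f = \sum_(i <- r) laurent_mul (F i) f.
Proof.
apply: (big_morph (laurent_mul^~ f)) => [a b|].
  exact: laurent_mulDl.
exact: laurent_mul0.
Qed.

Lemma laurent_sumr (I : Type) (r : seq I) (F : I -> laurent) f :
  laurent_mul f (\sum_(i <- r) F i) = \sum_(i <- r) laurent_mul f (F i).
Proof.
by rewrite laurent_mulC laurent_suml; apply: eq_bigr => i _; rewrite laurent_mulC.
Qed.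

Lemma laurent_mulA : associative laurent_mul.
Proof.
move=> f g h; have E k := laurentE (lsupp_uniq k) (fun x (H : x \in lsupp k) => H).
rewrite [f]E [g]E [h]E.
transitivity (\sum_(u <- lsupp f) \sum_(v <- lsupp g) \sum_(w <- lsupp h)
    lterm (lcoef f u * lcoef g v * lcoef h w) (u + v + w)).
  rewrite laurent_suml; apply: eq_bigr => u _.
  rewrite laurent_suml laurent_sumr; apply: eq_bigr => v _.
  rewrite !laurent_sumr; apply: eq_bigr => w _.
  by rewrite !laurent_mul_term mulrA addrA.
rewrite [in RHS](laurent_suml (lsupp f)) [RHS](laurent_suml (lsupp f)).
apply: eq_bigr => u _.
rewrite (laurent_sumr (lsupp g)) (laurent_suml (lsupp g)); apply: eq_bigr => v _.
by rewrite laurent_sumr; apply: eq_bigr => w _; rewrite !laurent_mul_term.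
Qed.

Lemma laurent_mul1 : left_id laurent_one laurent_mul.
Proof.
move=> f; have E k := laurentE (lsupp_uniq k) (fun x (H : x \in lsupp k) => H).
rewrite [f in LHS]E laurent_sumr [RHS]E.
by apply: eq_bigr => v _; rewrite laurent_mul_term mul1r add0r.
Qed.

Lemma laurent_1neq0 : laurent_one != 0.
Proof. by apply/eqP => /(congr1 (lcoef^~ 0)); rewrite lcoef_term eqxx lcoef0. Qed.

HB.instance Definition _ := GRing.Zmodule_isComNzRing.Build laurent
  laurent_mulA laurent_mulC laurent_mul1 laurent_mulDl laurent_1neq0.

End LaurentRing.

Definition tvar (i : 'I_4) : laurent := lterm 1 (delta_mx 0 i).

Definition laurent_bar (f : laurent) : laurent :=
  \sum_(w <- lsupp f) lterm (lcoef f w) (- w).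

(* The specialization t_1 t_2 t_3 t_4 = 1: every class of exponents modulo
   Z(1,1,1,1) is represented by its unique member with vanishing fourth entry. *)
Definition cy_weight (w : 'rV[int]_4) : 'rV[int]_4 :=
  w - const_mx (w 0 ord_max).

Definition laurent_cy (f : laurent) : laurent :=
  \sum_(w <- lsupp f) lterm (lcoef f w) (cy_weight w).

Definition box_weight (i j k l : nat) : 'rV[int]_4 :=
  \row_a [:: i%:Z; j%:Z; k%:Z; l%:Z]`_a.

Definition Zchar (p : solid_partition) : laurent :=
  \sum_(x <- finsupp p) \sum_(l < p x) lterm 1 (box_weight x.1.1 x.1.2 x.2 l).

Definition Vchar (p : solid_partition) : laurent :=
  let tinv := lterm 1 (const_mx (-1)) in
  Zchar p + laurent_bar (Zchar p) * tinv
  - Zchar p * laurent_bar (Zchar p) * (\prod_(i < 4) (1 - tvar i)) * tinv.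

(* lambda_{i+1} is [lam i]: the first three are the variables, and lambda_4 is
   minus their sum. *)
Notation Kfield := {fraction {mpoly rat[3]}}.

Definition lam (i : 'I_4) : Kfield :=
  tofrac (if unlift ord_max i is Some j then 'X_j else - \sum_(j < 3) 'X_j).

Definition weight_val (w : 'rV[int]_4) : Kfield := \sum_(i < 4) lam i *~ w 0 i.

(* [x ^ m] with [m : int] satisfies [0 ^ 0 = 1] and [0 ^ m = 0] for [m > 0]. *)
Definition eT (f : laurent) : Kfield :=
  \prod_(w <- lsupp (laurent_cy f)) weight_val w ^ lcoef (laurent_cy f) w.

(* A choice of signs for all the weights w_pi at once is a choice of one square
   root of (-1)^|pi| e_T(-V_pi) for every pi. *)
Definition sign_choice (w : solid_partition -> Kfield) : Prop :=
  forall p, w p ^+ 2 = (-1) ^+ sp_size p * eT (- Vchar p).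

Definition Lprod (R : comNzRingType) (l d : 'I_4 -> R) (p : solid_partition) : R :=
  \prod_(x <- finsupp p) \prod_(m < p x)
    \sum_(a < 4) (d a + (box_weight x.1.1 x.1.2 x.2 m 0 a)%:~R) * l a.

(* A power series is its sequence of coefficients. The coefficient of q^n of the
   result of each operation below only involves the input up to order n, and is
   computed on the truncated polynomials. *)
Definition fps (R : Type) : Type := nat -> R.

Section PowerSeries.

Variable R : comUnitRingType.
Implicit Types f : fps R.

Definition fps_trunc (n : nat) f : {poly R} := \poly_(i < n.+1) f i.

Definition fps_one : fps R := fun n => (n == 0%N)%:R.

(* exp f = sum_m f^m / m!, meant for f of zero constant term. *)
Definition fps_exp f : fps R := fun n =>
  (\sum_(m < n.+1) (m`!%:R)^-1 *: fps_trunc n f ^+ m)`_n.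

(* log f = sum_{m >= 1} (-1)^(m+1) (f - 1)^m / m, meant for f of constant term 1. *)
Definition fps_log f : fps R := fun n =>
  (\sum_(1 <= m < n.+1) ((-1) ^+ m.+1 / m%:R) *: (fps_trunc n f - 1) ^+ m)`_n.

(* f^-1 = sum_m (1 - f)^m, meant for f of constant term 1. *)
Definition fps_inv f : fps R := fun n =>
  (\sum_(m < n.+1) (1 - fps_trunc n f) ^+ m)`_n.

Definition fps_pow f (a : R) : fps R := fps_exp (fun n => a * fps_log f n).

Definition fps_negq f : fps R := fun n => (-1) ^+ n * f n.

(* M(q) = prod_{k >= 1} (1 - q^k)^-k; the factors with k > n do not contribute
   to the coefficient of q^n. *)
Definition macmahon : fps R := fun n =>
  (\prod_(1 <= k < n.+1)
     fps_trunc n (fps_inv (fun i => fps_one i - (i == k)%:R)) ^+ k)`_n.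

End PowerSeries.

Notation Kdfield := {fraction {mpoly Kfield[4]}}.

Definition K_to_Kd (x : Kfield) : Kdfield := tofrac (mpolyC 4 x).

Definition dvar (a : 'I_4) : Kdfield := tofrac 'X_a.

Definition Kd_lam (a : 'I_4) : Kdfield := K_to_Kd (lam a).

(* The exponent of M(-q). *)
Definition expo : Kdfield :=
  let l1 := Kd_lam (inord 0) in let l2 := Kd_lam (inord 1) in
  let l3 := Kd_lam (inord 2) in let l4 := Kd_lam (inord 3) in
  (\sum_(a < 4) dvar a * Kd_lam a)
  * (- (l1 * l2 * l3) - l1 * l2 * l4 - l1 * l3 * l4 - l2 * l3 * l4)
  / (l1 * l2 * l3 * l4).

Definition gen_identity (w : solid_partition -> Kfield) : Prop :=
  forall n : nat,
    \sum_(p \in sp_of_size n) Lprod Kd_lam dvar p * K_to_Kd (w p)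
    = fps_pow (fps_negq (macmahon _)) expo n.

(* The function field of the hyperplane, with coordinates lambda_1, lambda_2. *)
Notation Hfield := {fraction {mpoly rat[2]}}.

Definition restrH (f : {mpoly rat[3]}) : {mpoly rat[2]} :=
  f \mPo [tuple 'X_0; 'X_1; - 'X_0 - 'X_1].

(* No pole along the hyperplane: x is a fraction whose denominator does not
   vanish identically there. *)
Definition no_pole (x : Kfield) : Prop :=
  exists f g : {mpoly rat[3]}, restrH g != 0 /\ x = tofrac f / tofrac g.

Definition specializes (x : Kfield) (y : Hfield) : Prop :=
  exists f g : {mpoly rat[3]},
    [/\ restrH g != 0, x = tofrac f / tofrac g
      & y = tofrac (restrH f) / tofrac (restrH g)].

Lemma specializes_uniq x y y' : specializes x y -> specializes x y' -> y = y'.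
Proof.
move=> [f [g [g0 -> ->]]] [f' [g' [g'0 E ->]]].
have nz h : restrH h != 0 -> h != 0.
  by apply: contra_neq => ->; rewrite /restrH comp_mpoly0.
have tnz n (h : {mpoly rat[n]}) : h != 0 -> tofrac h != 0 by rewrite tofrac_eq0.
apply/eqP; rewrite eqr_div ?tnz // -!tofracM; apply/eqP; congr tofrac.
move/eqP: E; rewrite eqr_div ?tnz ?nz // -!tofracM tofrac_eq => /eqP.
by move=> /(congr1 restrH); rewrite /restrH !rmorphM.
Qed.

(* The variable of these polynomials is the formal variable d. *)
Definition specializes_poly (F : {poly Kfield}) (G : {poly Hfield}) : Prop :=
  forall n, specializes F`_n G`_n.

(* L_pi(0, 0, 0, -d) w_pi *)
Definition Lw (w : solid_partition -> Kfield) (p : solid_partition) : {poly Kfield} :=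
  Lprod (fun a => (lam a)%:P) (fun a => if a == ord_max then - 'X else 0) p
  * (w p)%:P.

Definition corner (p : solid_partition) : nat := p (0, 0, 0)%N.

Definition omega_spec (w : solid_partition -> Kfield) (p : solid_partition)
    (om : rat) : Prop :=
  0 < om /\
  specializes_poly (Lw w p)
    (((-1) ^+ sp_size p * ratr om) *: \prod_(l < corner p) ('X - (l%:R)%:P)).

(* Main.v *)
Require Import Defs.
From mathcomp Require Import all_boot all_order all_algebra.
From mathcomp Require Import finmap.
From mathcomp Require Import boolp classical_sets functions cardinality fsbigop.
From mathcomp.multinomials Require Import mpoly.
From mathcomp Require Import ring.

Set Implicit Arguments.
Unset Strict Implicit.
Unset Printing Implicit Defensive.

Import GRing.Theory Num.Theory.
Local Open Scope ring_scope.

(* Put (d_1, ..., d_4) = (0, 0, 0, -d) in (I): the exponent of M(-q) becomes a multiple of d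
   whose slope restricts to 1 on lambda_4 = 0. Restricting the identity to lambda_4 = 0 with (II)
   and replacing q by -q, the sum of omega_pi (d)_{pi_111} q^|pi| over pi is
   M(q)^d = sum_k (d)_k (M(q) - 1)^k / k!, where (d)_k is the falling factorial. Falling
   factorials are linearly independent, so each (d)_k may be replaced by t^k. *)

(** * Low-order coefficients of powers and products *)

Lemma coef_exp_low (R : comNzRingType) (p : {poly R}) (m i : nat) :
  p`_0 = 0 -> (i < m)%N -> (p ^+ m)`_i = 0.
Proof.
move=> p0 im; have -> : p = drop_poly 1 p * 'X.
  rewrite -[LHS](poly_take_drop 1) expr1 -[RHS]add0r; congr (_ + _).
  by apply/polyP => -[|j]; rewrite coef_take_poly coef0.
by rewrite exprMn coefMXn im.
Qed.

Lemma eq_coef_mul (R : nzRingType) (p p' q q' : {poly R}) (n : nat) :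
  (forall j, (j <= n)%N -> p`_j = p'`_j) ->
  (forall j, (j <= n)%N -> q`_j = q'`_j) ->
  forall j, (j <= n)%N -> (p * q)`_j = (p' * q')`_j.
Proof.
move=> pp qq j jn; rewrite !coefM; apply: eq_bigr => i _.
by rewrite pp ?qq // (leq_trans _ jn) ?leq_subr // -ltnS.
Qed.

Lemma eq_coef_exp (R : nzRingType) (p q : {poly R}) (n m : nat) :
  (forall j, (j <= n)%N -> p`_j = q`_j) ->
  forall j, (j <= n)%N -> (p ^+ m)`_j = (q ^+ m)`_j.
Proof.
move=> pq; elim: m => [//|m IH] j jn; rewrite !exprS.
exact: (eq_coef_mul pq IH).
Qed.

Lemma coef_fps_trunc (R : comUnitRingType) (f : fps R) n i :
  (i <= n)%N -> (fps_trunc n f)`_i = f i.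
Proof. by move=> le_in; rewrite coef_poly ltnS le_in. Qed.

(** * The binomial series in falling factorials *)

Definition falling (R : nzRingType) (a : R) (k : nat) : R :=
  \prod_(l < k) (a - l%:R).

(** The coefficient of q^n in (f - 1)^k, which truncating [f] at order [n] leaves unchanged. *)
Definition fps_subX (R : comUnitRingType) (f : fps R) (k n : nat) : R :=
  ((fps_trunc n f - 1) ^+ k)`_n.

Section BinomialSeries.

Variables (R : comUnitRingType) (natU : forall m : nat, (m.+1%:R : R) \is a GRing.unit).

Let factU m : (m`!%:R : R) \is a GRing.unit.
Proof. by rewrite -(prednK (fact_gt0 m)) natU. Qed.

(** Taylor polynomial of log(1 + X), kept in a free variable so that it can be differentiated before
    f - 1 is substituted. *)
Let logpoly (n : nat) : {poly R} :=
  \sum_(1 <= m < n.+1) ((-1) ^+ m.+1 / m%:R) *: 'X ^+ m.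

Let logpoly0 n : (logpoly n)`_0 = 0.
Proof.
rewrite /logpoly coef_sum big_nat big1 // => m /andP[m0 _].
by rewrite coefZ coefXn eq_sym (gtn_eqF m0) mulr0.
Qed.

(** The derivative is a geometric sum in [- 'X], whence (1 + X) (log(1 + X))' = 1 up to the error
    (-X)^n. *)
Let deriv_logpoly n : (1 + 'X) * (logpoly n)^`() = 1 - (- 'X) ^+ n.
Proof.
rewrite /logpoly raddf_sum /= big_add1 /= big_mkord.
have -> : 1 + 'X = - (- 'X - 1) :> {poly R} by ring.
rewrite mulNr -[RHS]opprB; congr (- _); rewrite subrX1; congr (_ * _).
apply: eq_bigr => m _; rewrite derivZ derivXn /= -scaler_nat scalerA divrK ?natU //.
by rewrite [RHS]exprNn -mul_polyC !exprS !mulN1r opprK polyC_exp polyCN.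
Qed.

Let exppoly (n : nat) (a : R) : {poly R} :=
  \sum_(m < n.+1) (m`!%:R)^-1 *: (a *: logpoly n) ^+ m.

(* [(1 + u)^a] is determined by [(1 + u) F' = a F] and [F(0) = 1]. *)
Let coef_exppoly n a k : (k <= n)%N -> (exppoly n a)`_k = falling a k / k`!%:R.
Proof.
elim: k => [|k IH] kn.
  rewrite /falling big_ord0 divr1 /exppoly big_ord_recl expr0 coefD coefZ coef1.
  rewrite coef_sum big1 ?addr0 ?invr1 ?mul1r // => m _.
  by rewrite coefZ coef_exp_low ?mulr0 // coefZ logpoly0 mulr0.
(* Differentiation costs the exponential one term, so F' involves the shorter sum [S]; since
   [logpoly n] has no constant term, [S] and F agree below degree [n]. *)
pose S : {poly R} := \sum_(m < n) (m`!%:R)^-1 *: (a *: logpoly n) ^+ m.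
have FS : exppoly n a = S + (n`!%:R)^-1 *: (a *: logpoly n) ^+ n.
  by rewrite /exppoly big_ord_recr.
have dF : (exppoly n a)^`() = (a *: (logpoly n)^`()) * S.
  rewrite /exppoly raddf_sum big_ord_recl /= derivZ expr0 derivC scaler0 add0r.
  rewrite /S mulr_sumr; apply: eq_bigr => m _.
  rewrite derivZ deriv_exp -scaler_nat scalerA factS natrM invrM ?natU ?factU //.
  by rewrite divrK ?natU // derivZ -scalerAr.
have low : S`_k = (exppoly n a)`_k.
  by rewrite FS coefD coefZ coef_exp_low ?mulr0 ?addr0 // coefZ logpoly0 mulr0.
have /(congr1 (fun p : {poly R} => p`_k)) :
    (1 + 'X) * (exppoly n a)^`() = a *: (S - (- 'X) ^+ n * S).
  by rewrite dF -scalerAl -scalerAr mulrA deriv_logpoly mulrBl mul1r.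
(* As k < n, the error term (-X)^n does not reach the coefficient of X^k. *)
rewrite mulrDl mul1r coefD coefZ coefB exprNn -mulrA mulrCA coefXnM kn subr0.
rewrite coefXM !coef_deriv low => E.
(* The recurrence for the binomial coefficients; k = 0 is treated apart because X F' has no constant
   term. *)
have {E} : (exppoly n a)`_k.+1 * k.+1%:R = (a - k%:R) * (exppoly n a)`_k.
  rewrite mulrBl -E mulr_natr; case: (k) => [|j] /=; last by ring.
  by rewrite mul0r subr0 addr0.
rewrite IH ?(ltnW kn) // => E; apply: (mulIr (natU k)); rewrite E.
rewrite /falling big_ord_recr /= factS natrM invrM ?natU ?factU //.
by rewrite !mulrA divrK ?natU //; ring.
Qed.

(** Newton's series for (1 + (f - 1))^a, cut at k <= n because (f - 1)^k starts at order k. Each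
    coefficient is polynomial in [a], so [a] can be specialized later. *)
Lemma fps_powE (f : fps R) (a : R) (n : nat) : f 0%N = 1 ->
  fps_pow f a n = \sum_(k < n.+1) falling a k / k`!%:R * fps_subX f k n.
Proof.
move=> f0; pose g := fps_trunc n f - 1.
have g0 : g`_0 = 0 by rewrite coefB coef1 coef_fps_trunc // f0 subrr.
have logE i : (i <= n)%N -> fps_log f i = (logpoly n \Po g)`_i.
  move=> le_in; rewrite /fps_log /logpoly raddf_sum /= !coef_sum.
  rewrite (@big_cat_nat _ _ _ i.+1 1 n.+1) //=.
  rewrite [X in _ = _ + X]big_nat [X in _ = _ + X]big1 ?addr0 => [|m /andP[im _]].
    apply: eq_bigr => m _.
    rewrite linearZ /= comp_Xn_poly !coefZ; congr (_ * _).
    apply: (@eq_coef_exp _ _ _ i) => // j ji.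
    by rewrite !coefB !coef_fps_trunc // (leq_trans ji).
  by rewrite linearZ /= comp_Xn_poly coefZ coef_exp_low ?mulr0.
have -> : fps_pow f a n = (exppoly n a \Po g)`_n.
  rewrite /fps_pow /fps_exp /exppoly raddf_sum /= !coef_sum.
  apply: eq_bigr => m _; rewrite linearZ /= rmorphXn /= !coefZ; congr (_ * _).
  apply: (@eq_coef_exp _ _ _ n) => // j jn.
  by rewrite coef_fps_trunc // linearZ /= coefZ logE.
rewrite coef_comp_poly.
(* A common range: the size of [exppoly n a] may be smaller or larger than n + 1. *)
pose N := maxn n.+1 (size (exppoly n a)).
rewrite (big_ord_widen N (fun i => (exppoly n a)`_i * (g ^+ i)`_n)) ?leq_maxr //.
rewrite (big_ord_widen N (fun i => falling a i / i`!%:R * fps_subX f i n)) ?leq_maxl //.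
rewrite big_mkcond [RHS]big_mkcond /=; apply: eq_bigr => k _.
rewrite ltnS; case: (leqP k n) => kn.
  rewrite -(@coef_exppoly n) //; case: ltnP => // /leq_sizeP -> //.
  by rewrite mul0r.
by case: ifP => // _; rewrite coef_exp_low ?mulr0.
Qed.

End BinomialSeries.

(** * Falling factorials as a basis *)

Lemma rmorph_falling (R S : nzRingType) (f : {rmorphism R -> S}) (a : R) k :
  f (falling a k) = falling (f a) k.
Proof.
by rewrite rmorph_prod; apply: eq_bigr => l _; rewrite rmorphB rmorph_nat.
Qed.

Lemma falling_polyE (R : nzRingType) k :
  falling ('X : {poly R}) k = \prod_(l < k) ('X - (l%:R)%:P).
Proof. by apply: eq_bigr => l _; rewrite polyC_natr. Qed.

(** [falling 'X k] is monic of degree [k], so the system is triangular: the top degree fixes the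
    last coefficient, and induction gives the others. *)
Lemma falling_coef_inj (R : idomainType) (N : nat) (a b : nat -> R) :
  \sum_(k < N) a k *: falling 'X k = \sum_(k < N) b k *: falling 'X k :> {poly R} ->
  forall k, (k < N)%N -> a k = b k.
Proof.
have size_falling k : size (falling ('X : {poly R}) k) = k.+1.
  rewrite falling_polyE -(big_mkord predT (fun l => 'X - (l%:R)%:P)).
  by rewrite size_prod_XsubC size_iota subn0.
have lead_falling k : (falling ('X : {poly R}) k)`_k = 1.
  have /monicP : falling ('X : {poly R}) k \is monic.
    by rewrite falling_polyE monic_prod_XsubC.
  by rewrite /lead_coef size_falling.
have low (d : nat -> R) n : (\sum_(k < n) d k *: falling ('X : {poly R}) k)`_n = 0.
  rewrite coef_sum big1 // => k _; rewrite coefZ.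
  have /leq_sizeP -> := leqnn (size (falling ('X : {poly R}) k)); first exact: mulr0.
  by rewrite size_falling.
elim: N => [//|N IH]; rewrite !big_ord_recr /= => E k.
have aN : a N = b N.
  have := congr1 (fun p : {poly R} => p`_N) E.
  by rewrite !coefD !low !coefZ lead_falling !mulr1 !add0r.
rewrite ltnS leq_eqVlt => /predU1P[-> //|]; apply: IH.
by move: E; rewrite aN => /addIr.
Qed.

(** Applied both to falling factorials and to powers of ['X]: the same coefficients occur, which is
    how (d)_k is traded for t^k. *)
Lemma sum_by_value (R : nzRingType) (V : lmodType R) (T : eqType) (s : seq T)
    (a : T -> R) (c : T -> nat) (F : nat -> V) (n : nat) :
  (forall x, x \in s -> (c x <= n)%N) ->
  \sum_(x <- s) a x *: F (c x)
  = \sum_(k < n.+1) (\sum_(x <- s | c x == k) a x) *: F k.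
Proof.
move=> cn; under [RHS]eq_bigr do rewrite scaler_suml.
rewrite (exchange_big_dep predT) //= big_seq [RHS]big_seq; apply: eq_bigr => x xs.
under eq_bigl do rewrite eq_sym.
by rewrite (big_ord1_eq _ (fun k => a x *: F k)) ltnS cn.
Qed.

(** * Series under ring morphisms and under q -> -q *)

Section MapSeries.

Variables (R S : comUnitRingType) (h : {rmorphism R -> S}).

Lemma map_fps_trunc (f : fps R) (g : fps S) n :
  (forall i, h (f i) = g i) -> map_poly h (fps_trunc n f) = fps_trunc n g.
Proof.
move=> fg; apply/polyP => i; rewrite coef_map !coef_poly.
by case: ifP => _; [exact: fg | exact: rmorph0].
Qed.

Lemma map_fps_subX (f : fps R) (g : fps S) k n :
  (forall i, h (f i) = g i) -> h (fps_subX f k n) = fps_subX g k n.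
Proof.
by move=> fg; rewrite -coef_map rmorphXn rmorphB rmorph1 /= (map_fps_trunc _ fg).
Qed.

Lemma map_fps_inv (f : fps R) (g : fps S) n :
  (forall i, h (f i) = g i) -> h (fps_inv f n) = fps_inv g n.
Proof.
move=> fg; rewrite -coef_map rmorph_sum; congr (nth _ (polyseq _) _).
by apply: eq_bigr => m _; rewrite rmorphXn rmorphB rmorph1 /= (map_fps_trunc _ fg).
Qed.

Lemma map_macmahon n : h (macmahon R n) = macmahon S n.
Proof.
rewrite -coef_map rmorph_prod; congr (nth _ (polyseq _) _).
apply: eq_bigr => k _; rewrite rmorphXn /=; congr (_ ^+ _).
apply: map_fps_trunc => i; apply: map_fps_inv => j.
by rewrite rmorphB !rmorph_nat.
Qed.

End MapSeries.

Lemma macmahon0 (R : comUnitRingType) : macmahon R 0 = 1.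
Proof. by rewrite /macmahon big_geq // coef1. Qed.

Lemma coef_comp_polyNX (R : comNzRingType) (p : {poly R}) n :
  (p \Po - 'X)`_n = (-1) ^+ n * p`_n.
Proof.
elim/poly_ind: p n => [|p c IH] n; first by rewrite comp_poly0 !coef0 mulr0.
rewrite comp_poly_MXaddC coefD mulrN coefN coefMX coefC.
rewrite coefD coefMX coefC; case: n => [|n] /=; first by rewrite expr0 oppr0 mul1r.
by rewrite !addr0 IH exprS mulN1r mulNr.
Qed.

(** Composition with [- 'X] realizes q -> -q and is a ring morphism, so it commutes with subtracting
    1 and taking powers. *)
Lemma fps_subX_negq (R : comUnitRingType) (f : fps R) k n :
  fps_subX (fps_negq f) k n = (-1) ^+ n * fps_subX f k n.
Proof.
rewrite -coef_comp_polyNX rmorphXn rmorphB rmorph1 /=.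
congr (nth _ (polyseq ((_ - 1) ^+ _)) _); apply/polyP => i; rewrite coef_comp_polyNX !coef_poly.
by case: ifP => _; rewrite ?mulr0.
Qed.

Lemma fps_exp_scale (R : comUnitRingType) (f : fps R) (a : R) n :
  fps_exp (fun m => a * (f m - fps_one R m)) n
  = \sum_(k < n.+1) (k`!%:R)^-1 * a ^+ k * fps_subX f k n.
Proof.
rewrite /fps_exp coef_sum; apply: eq_bigr => k _; rewrite coefZ -mulrA.
congr (_ * _); rewrite -coefZ -exprZn; congr (nth _ (polyseq (_ ^+ _)) _).
apply/polyP => i; rewrite coefZ coefB !coef_poly coef1 ltnS.
by case: leqP => // ni; rewrite gtn_eqF ?subr0 ?mulr0 // (leq_ltn_trans _ ni).
Qed.

Lemma rmorph_Lprod (R S : comNzRingType) (f : {rmorphism R -> S})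
    (l d : 'I_4 -> R) (l' d' : 'I_4 -> S) p :
  (forall a, f (l a) = l' a) -> (forall a, f (d a) = d' a) ->
  f (Lprod l d p) = Lprod l' d' p.
Proof.
move=> fl fd; rewrite rmorph_prod; apply: eq_bigr => x _.
rewrite rmorph_prod; apply: eq_bigr => m _.
rewrite rmorph_sum; apply: eq_bigr => a _.
by rewrite rmorphM rmorphD rmorph_int fl fd.
Qed.

(** * Specialization to lambda_4 = 0 *)

(** Bundled as a morphism; it agrees with [ratr], the embedding used in [omega_spec]. *)
Definition rat_frac (n : nat) : {rmorphism rat -> {fraction {mpoly rat[n]}}} :=
  @tofrac {mpoly rat[n]} \o @mpolyC n rat.

Lemma restrHD f g : restrH (f + g) = restrH f + restrH g.
Proof. by rewrite /restrH rmorphD. Qed.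

Lemma restrHM f g : restrH (f * g) = restrH f * restrH g.
Proof. by rewrite /restrH rmorphM. Qed.

Lemma restrHX (i : 'I_3) : restrH 'X_i = [:: 'X_0; 'X_1; - 'X_0 - 'X_1]`_i.
Proof. by rewrite /restrH comp_mpolyXU. Qed.

(** Restriction is a ring morphism into a domain, so a product of denominators with nonzero
    restrictions has nonzero restriction. *)
Lemma specializesD x x' y y' :
  specializes x y -> specializes x' y' -> specializes (x + x') (y + y').
Proof.
have tnz n (h : {mpoly rat[n]}) : h != 0 -> tofrac h != 0 by rewrite tofrac_eq0.
have nz h : restrH h != 0 -> h != 0.
  by apply: contra_neq => ->; rewrite /restrH comp_mpoly0.
move=> [f [g [g0 -> ->]]] [f' [g' [g'0 -> ->]]].
exists (f * g' + f' * g), (g * g'); split.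
- by rewrite restrHM mulf_neq0.
- by rewrite addf_div ?tnz ?nz // tofracD !tofracM.
- by rewrite addf_div ?tnz // restrHD !restrHM !(tofracD, tofracM).
Qed.

Lemma specializesM x x' y y' :
  specializes x y -> specializes x' y' -> specializes (x * x') (y * y').
Proof.
move=> [f [g [g0 -> ->]]] [f' [g' [g'0 -> ->]]].
exists (f * f'), (g * g'); split.
- by rewrite restrHM mulf_neq0.
- by rewrite mulf_div !tofracM.
- by rewrite mulf_div !restrHM !tofracM.
Qed.

Lemma specializes_tofrac f : specializes (tofrac f) (tofrac (restrH f)).
Proof. by exists f, 1; rewrite /restrH rmorph1 oner_neq0 !tofrac1 !divr1. Qed.

Lemma specializes_rat q : specializes (rat_frac 3 q) (rat_frac 2 q).
Proof. by have := specializes_tofrac q%:MP; rewrite /restrH comp_mpolyC. Qed.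

Lemma specializes0 : specializes 0 0.
Proof. by have := specializes_rat 0; rewrite !rmorph0. Qed.

Lemma specializes_sum (I : Type) (r : seq I) (P : pred I) F G :
  (forall i, P i -> specializes (F i) (G i)) ->
  specializes (\sum_(i <- r | P i) F i) (\sum_(i <- r | P i) G i).
Proof.
move=> FG; apply: (big_ind2 specializes) => //; first exact: specializes0.
by move=> *; apply: specializesD.
Qed.

Lemma specializes_polyC x y : specializes x y -> specializes_poly x%:P y%:P.
Proof. by move=> xy n; rewrite !coefC; case: ifP => // _; exact: specializes0. Qed.

Lemma specializes_polyX : specializes_poly 'X 'X.
Proof.
move=> n; rewrite !coefX -(rmorph_nat (rat_frac 3)) -(rmorph_nat (rat_frac 2)).
exact: specializes_rat.
Qed.

Lemma specializes_polyD F F' G G' : specializes_poly F G ->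
  specializes_poly F' G' -> specializes_poly (F + F') (G + G').
Proof. by move=> FG FG' n; rewrite !coefD; apply: specializesD. Qed.

Lemma specializes_polyM F F' G G' : specializes_poly F G ->
  specializes_poly F' G' -> specializes_poly (F * F') (G * G').
Proof.
move=> FG FG' n; rewrite !coefM.
by apply: specializes_sum => i _; apply: specializesM.
Qed.

Lemma specializes_poly_sum (I : Type) (r : seq I) F G :
  (forall i, specializes_poly (F i) (G i)) ->
  specializes_poly (\sum_(i <- r) F i) (\sum_(i <- r) G i).
Proof. by move=> FG n; rewrite !coef_sum; apply: specializes_sum => i _; exact: FG. Qed.

Lemma specializes_poly_falling F G k :
  specializes_poly F G -> specializes_poly (falling F k) (falling G k).
Proof.
move=> FG; apply: (big_ind2 specializes_poly) => [||l _].
- have := specializes_polyC (specializes_rat 1).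
  by rewrite !(rmorph1 (rat_frac _)) !polyC1.
- by move=> *; apply: specializes_polyM.
- apply: specializes_polyD => //; rewrite -!polyC_natr -!polyCN.
  rewrite -(rmorph_nat (rat_frac 3)) -(rmorph_nat (rat_frac 2)) -!rmorphN.
  exact/specializes_polyC/specializes_rat.
Qed.

(** This restricts an identity of K[d]: one polynomial is specialized in two ways and the results
    are equated. *)
Lemma specializes_poly_uniq F G G' :
  specializes_poly F G -> specializes_poly F G' -> G = G'.
Proof. by move=> FG FG'; apply/polyP => n; apply: specializes_uniq (FG n) (FG' n). Qed.

(* The exponent of M(-q) is [expo_slope * d] at (d_1, ..., d_4) = (0, 0, 0, -d). *)
Definition expo_scale : Kfield :=
  let l1 := lam (inord 0) in let l2 := lam (inord 1) in
  let l3 := lam (inord 2) in let l4 := lam (inord 3) in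
  (- (l1 * l2 * l3) - l1 * l2 * l4 - l1 * l3 * l4 - l2 * l3 * l4)
  / (l1 * l2 * l3 * l4).

Definition expo_slope : Kfield := - lam ord_max * expo_scale.

Lemma lamE (j : 'I_3) : lam (lift ord_max j) = tofrac 'X_j.
Proof. by rewrite /lam liftK. Qed.

Lemma lam_max : lam ord_max = tofrac (- \sum_(j < 3) 'X_j).
Proof. by rewrite /lam unlift_none. Qed.

Lemma mpolyX_neq0 n (R : nzRingType) (i : 'I_n) : 'X_i != 0 :> {mpoly R[n]}.
Proof.
apply/eqP => /(congr1 (mcoeff U_(i))) /eqP.
by rewrite mcoeff0 mcoeffX eqxx oner_eq0.
Qed.

Lemma sumX2_neq0 : - 'X_0 - 'X_1 != 0 :> {mpoly rat[2]}.
Proof.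
apply/eqP => /(congr1 (mcoeff U_(0))); by rewrite mcoeff0 mcoeffB mcoeffN !mcoeffXU.
Qed.

(** With [d] = lambda_4, the factor contributed by d_4 cancels the pole of the exponent along
    lambda_4 = 0. *)
Lemma slope_cancel (F : fieldType) (a b c d : F) :
  a != 0 -> b != 0 -> c != 0 -> d != 0 ->
  - d * ((- (a * b * c) - a * b * d - a * c * d - b * c * d) / (a * b * c * d))
  = (a * b * c + a * b * d + a * c * d + b * c * d) / (a * b * c).
Proof. by move=> *; field; do ?[apply/andP; split]. Qed.

(** On lambda_4 = 0 only lambda_1 lambda_2 lambda_3 survives in the numerator, and this is also the
    denominator. *)
Lemma expo_slope_specializes : specializes expo_slope 1.
Proof.
have i0 : inord 0 = lift ord_max (0 : 'I_3) :> 'I_4 by apply/val_inj; rewrite /= inordK.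
have i1 : inord 1 = lift ord_max (1 : 'I_3) :> 'I_4 by apply/val_inj; rewrite /= inordK.
have i2 : inord 2 = lift ord_max (2 : 'I_3) :> 'I_4 by apply/val_inj; rewrite /= inordK.
have i3 : inord 3 = ord_max :> 'I_4 by apply/val_inj; rewrite /= inordK.
pose X4 : {mpoly rat[3]} := - \sum_(j < 3) 'X_j.
have X40 : X4 != 0.
  rewrite oppr_eq0; apply/eqP => /(congr1 (mcoeff U_(0))).
  by rewrite raddf_sum /= !big_ord_recl big_ord0 !mcoeffXU mcoeff0.
have rX4 : restrH X4 = 0.
  rewrite /X4 !big_ord_recl big_ord0 addr0 -mulN1r.
  rewrite restrHM !restrHD !restrHX /=; ring.
(* Numerator and denominator as left by [slope_cancel]. *)
exists ('X_0 * 'X_1 * 'X_2 + 'X_0 * 'X_1 * X4 + 'X_0 * 'X_2 * X4 + 'X_1 * 'X_2 * X4).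
exists ('X_0 * 'X_1 * 'X_2).
have rg : restrH ('X_0 * 'X_1 * 'X_2) != 0.
  by rewrite !restrHM !restrHX /= !mulf_neq0 ?mpolyX_neq0 ?sumX2_neq0.
split=> //.
  rewrite /expo_slope /expo_scale i0 i1 i2 i3 !lamE lam_max -/X4 !tofracD !tofracM.
  by rewrite slope_cancel ?tofrac_eq0 ?mpolyX_neq0.
by rewrite !restrHD ![restrH (_ * X4)]restrHM rX4 !mulr0 !addr0 divff ?tofrac_eq0.
Qed.


(* The coefficient of q^n in (M(q) - 1)^k / k!, so that [q^n] M(q)^d is the sum over k of
   [macmahon_coef n k * d (d - 1) ... (d - k + 1)]. *)
Definition macmahon_coef (n k : nat) : rat :=
  (k`!%:R)^-1 * fps_subX (macmahon rat) k n.

(** * The identity (I) at (0, 0, 0, -d) and its restriction *)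

(** By [fps_powE], both sides of (I) at order [n] come from polynomials in d_1, ..., d_4 over K,
    where values can be substituted, unlike in the fraction field. *)
Lemma gen_identity_corner w n : gen_identity w ->
  \sum_(p <- fset_set (sp_of_size n)) Lw w p
  = \sum_(k < n.+1) (rat_frac 3 ((-1) ^+ n * macmahon_coef n k))%:P
                    * falling (expo_slope%:P * 'X) k.
Proof.
move=> /(_ n); rewrite fsbig_finite; last exact: finite_sp_of_size.
pose toKd : {rmorphism Kfield -> Kdfield} := @tofrac {mpoly Kfield[4]} \o @mpolyC 4 Kfield.
pose ratKd : {rmorphism rat -> Kdfield} := toKd \o rat_frac 3.
rewrite fps_powE; first last.
- by rewrite /fps_negq expr0 mul1r macmahon0.
- by move=> m; rewrite -(rmorph_nat ratKd) rmorph_unit // unitfE pnatr_eq0.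
(* The exponent is linear in the d_a over K, hence already a polynomial. *)
pose E : {mpoly Kfield[4]} := (\sum_(a < 4) 'X_a * (lam a)%:MP) * expo_scale%:MP.
have -> : expo = tofrac E.
  rewrite /expo /E tofracM -[tofrac _%:MP]/(toKd _) /expo_scale -mulrA; congr (_ * _).
    by rewrite [RHS]rmorph_sum; apply: eq_bigr => a _; rewrite [RHS]rmorphM.
  by rewrite fmorph_div !rmorphB rmorphN !rmorphM.
have -> : \sum_(p <- fset_set (sp_of_size n)) Lprod Kd_lam dvar p * K_to_Kd (w p)
    = tofrac (\sum_(p <- fset_set (sp_of_size n))
        Lprod (fun a => (lam a)%:MP) (fun a => 'X_a) p * (w p)%:MP).
  rewrite rmorph_sum; apply: eq_bigr => p _; rewrite rmorphM; congr (_ * _).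
  by apply/esym/rmorph_Lprod.
have -> : \sum_(k < n.+1) falling (tofrac E) k / k`!%:R
      * fps_subX (fps_negq (macmahon Kdfield)) k n
    = tofrac (\sum_(k < n.+1)
        (rat_frac 3 ((-1) ^+ n * macmahon_coef n k))%:MP * falling E k).
  rewrite rmorph_sum; apply: eq_bigr => k _; rewrite [RHS]tofracM.
  rewrite [X in _ = _ * X]rmorph_falling [RHS]mulrC -mulrA; congr (_ * _).
  rewrite -[RHS]/(ratKd _) /macmahon_coef fps_subX_negq.
  rewrite -(map_fps_subX k n (map_macmahon ratKd)).
  by rewrite !rmorphM rmorphXn rmorphN1 fmorphV rmorph_nat mulrCA.
(* [tofrac] is injective, so the identity descends to polynomials. *)
move/eqP; rewrite tofrac_eq => /eqP.
pose dX (a : 'I_4) : {poly Kfield} := if a == ord_max then - 'X else 0.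
pose ev : {rmorphism {mpoly Kfield[4]} -> {poly Kfield}} := mmap (@polyC Kfield) dX.
have evC x : ev x%:MP = x%:P by rewrite [LHS]mmapC.
have evX a : ev 'X_a = dX a by rewrite [LHS]mmapX mmap1U.
have evE : ev E = expo_slope%:P * 'X.
  rewrite [ev E]rmorphM evC rmorph_sum (bigD1 ord_max) //= big1 => [|a /negPf am].
    rewrite addr0 rmorphM evX evC /dX eqxx /expo_slope.
    by move: expo_scale => s; rewrite polyCM polyCN; ring.
  by rewrite rmorphM evX /dX am mul0r.
have evL p : ev (Lprod (fun a => (lam a)%:MP) (fun a => 'X_a) p * (w p)%:MP) = Lw w p.
  by rewrite rmorphM evC; congr (_ * _); apply: rmorph_Lprod.
move=> /(congr1 ev).
rewrite [LHS]rmorph_sum [RHS]rmorph_sum (eq_bigr _ (fun p _ => evL p)) => ->.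
by apply: eq_bigr => k _; rewrite [LHS]rmorphM evC rmorph_falling evE.
Qed.

(** Up to the sign (-1)^n and the embedding of constants, both sides specialize the sum of the
    [Lw w p]: the left by (II), the right by (I) with slope restricting to 1. *)
Lemma sum_omega_falling w (omega : solid_partition -> rat) n :
  gen_identity w -> (forall p, omega_spec w p (omega p)) ->
  \sum_(p <- fset_set (sp_of_size n)) omega p *: falling 'X (corner p)
  = \sum_(k < n.+1) macmahon_coef n k *: falling ('X : {poly rat}) k.
Proof.
move=> /gen_identity_corner genw Hom.
have sz p : p \in fset_set (sp_of_size n) -> sp_size p = n.
  by rewrite in_fset_set ?inE //; exact: finite_sp_of_size.
have sgnU : (-1) ^+ n != 0 :> rat by rewrite signr_eq0.
(* This restores the sign present both in (II), where |pi| = n, and in M(-q). *)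
apply: (scalerI sgnU); apply: (map_poly_inj (rat_frac 2)).
rewrite !scaler_sumr !rmorph_sum.
have mapE a k : map_poly (rat_frac 2) ((-1) ^+ n *: (a *: falling ('X : {poly rat}) k))
    = (rat_frac 2 ((-1) ^+ n * a))%:P * falling 'X k.
  rewrite scalerA map_polyZ mul_polyC; congr (_ *: _).
  by rewrite [LHS]rmorph_falling /= map_polyX.
rewrite (eq_bigr _ (fun p _ => mapE _ _)) [RHS](eq_bigr _ (fun k _ => mapE _ _)).
apply: (@specializes_poly_uniq (\sum_(p <- fset_set (sp_of_size n)) Lw w p)).
  rewrite big_seq [X in specializes_poly _ X]big_seq => m; rewrite !coef_sum.
  apply: specializes_sum => p /sz pn; have [_ /(_ m)] := Hom p.
  by rewrite -(fmorph_eq_rat (rat_frac 2)) falling_polyE mul_polyC pn rmorphM rmorphXn rmorphN1.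
rewrite genw; apply: specializes_poly_sum => k.
apply: specializes_polyM; first exact/specializes_polyC/specializes_rat.
(* ['X] is written as 1 * ['X] to exhibit the value 1 of the restricted slope. *)
apply: specializes_poly_falling; rewrite -['X in X in specializes_poly _ X]mul1r -polyC1.
apply: specializes_polyM specializes_polyX.
exact: specializes_polyC expo_slope_specializes.
Qed.

Theorem theorem1p12
  (HI : exists! w : solid_partition -> Kfield, sign_choice w /\ gen_identity w)
  (HII : forall w : solid_partition -> Kfield,
     sign_choice w -> gen_identity w ->
     forall p : solid_partition,
       [/\ forall n : nat, no_pole (Lw w p)`_n,
           exists P : {poly rat}, specializes_poly (Lw w p) (map_poly ratr P)
         & exists om : rat, omega_spec w p om])
  (omega : solid_partition -> rat)
  (Homega : forall w : solid_partition -> Kfield,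
     sign_choice w -> gen_identity w ->
     forall p : solid_partition, omega_spec w p (omega p)) :
  (forall n : nat,
     \sum_(p \in sp_of_size n) omega p *: 'X^(corner p)
     = fps_exp (fun m => 'X * (macmahon _ m - fps_one _ m)) n :> {poly rat})
  /\
  (forall n : nat,
     \sum_(p \in sp_of_size n) omega p
     = fps_exp (fun m => macmahon _ m - fps_one _ m) n :> rat).
Proof.
have [w [[signw genw] _]] := HI.
have omw := Homega w signw genw.
(* pi_111 <= |pi| = n, so grouping by pi_111 uses only k <= n. *)
have corner_le n p : p \in fset_set (sp_of_size n) -> (corner p <= n)%N.
  rewrite in_fset_set ?inE; last exact: finite_sp_of_size.
  by move=> <-; exact: sp_le_size.
(* Coefficients are compared in the basis of falling factorials. *)
have coefE n k : (k < n.+1)%N ->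
    \sum_(p <- fset_set (sp_of_size n) | corner p == k) omega p = macmahon_coef n k.
  move: k; apply: falling_coef_inj.
  by rewrite -(sum_omega_falling n genw omw) (sum_by_value _ _ (corner_le n)).
have sumE n : \sum_(p \in sp_of_size n) omega p *: 'X^(corner p)
    = \sum_(k < n.+1) macmahon_coef n k *: 'X^k :> {poly rat}.
  rewrite fsbig_finite; last exact: finite_sp_of_size.
  rewrite (sum_by_value _ (fun k => 'X^k) (corner_le n)).
  by apply: eq_bigr => k _; rewrite coefE.
split=> n.
  rewrite sumE fps_exp_scale; apply: eq_bigr => k _.
  (* Here ['X] is t, and the MacMahon series over Q[t] is the image of the rational one. *)
  rewrite -(map_fps_subX k n (map_macmahon (@polyC rat))) -mul_polyC polyCM.
  by rewrite -polyCV polyC_natr mulrAC.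
(* The second identity is the first at t = 1. *)
have := congr1 (fun p : {poly rat} => p.[1]) (sumE n).
rewrite !fsbig_finite; try exact: finite_sp_of_size.
rewrite !horner_sum => E.
transitivity (\sum_(k < n.+1) macmahon_coef n k).
  transitivity (\sum_(p <- fset_set (sp_of_size n)) (omega p *: 'X^(corner p)).[1]).
    by apply: eq_bigr => p _; rewrite hornerZ hornerXn expr1n mulr1.
  by rewrite E; apply: eq_bigr => k _; rewrite hornerZ hornerXn expr1n mulr1.
have -> : (fun m => macmahon rat m - fps_one rat m)
    = (fun m => 1 * (macmahon rat m - fps_one rat m)).
  by apply: funext => m; rewrite mul1r.
by rewrite fps_exp_scale; apply: eq_bigr => k _; rewrite expr1n mulr1.
Qed.
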